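(* Consider a generalized percolation, given by a measure-preserving Borel action $\Gamma\curvearrowright(X,\mathbb{P})$ and a $\Gamma$-equivariant map $\pi:X\to\{0,1\}^E$, such that the action $\Gamma\curvearrowright(X,\mathbb{P})$ is strongly ergodic and $\mathbb{P}[X_\infty]>0$. Then the generalized percolation satisfies the Strong Indistinguishability Property if and only if the equivalence relation $R$ on $X_\infty$ is $\frac{\mathbb{P}}{\mathbb{P}[X_\infty]}$-strongly ergodic.
   Context: Setting. $\Gamma$ is a finitely generated group and $\mathcal{G}=(V,E)$ is a Cayley graph of $\Gamma$ relative to a finite generating set $S$ (vertex set $\Gamma$, an edge between $\gamma$ and $\gamma s$ for $\gamma\in\Gamma$, $s\in S$), endowed with the left action of $\Gamma$ by graph automorphisms, which is free and transitive on $V$. A reference vertex $\rho\in V$ is fixed, so every $v\in V$ is uniquely $\gamma\cdot\rho$. $\Gamma$ acts on $\Omega=\{0,1\}^E$ by $(\gamma\cdot\omega)(e)=\omega(\gamma^{-1}\cdot e)$. Each $\omega\in\Omega$ is viewed as the subgraph with vertex set $V$ and edge set $\omega^{-1}(\{1\})$; its connected components are its clusters, $\mathcal{C}(\omega,v)$ is the cluster containing $v$, and $u\overset{\omega}{\longleftrightarrow}v$ means that $u,v$ are in the same cluster of $\omega$. A generalized percolation is a Borel action of $\Gamma$ on an atomless standard probability space $(X,\mathbb{P})$ (standard Borel space with an atomless Borel probability measure) preserving $\mathbb{P}$, together with a $\Gamma$-equivariant Borel map $\pi:X\to\Omega$. Put $V_\infty^\pi(x)=\{v\in V:|\mathcal{C}(\pi(x),v)|=\infty\}$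 and $X_\infty=\{x\in X:|\mathcal{C}(\pi(x),\rho)|=\infty\}$. The cluster equivalence relation $R_{cl}$ on $X$: $x\,R_{cl}\,x'$ iff there is $\gamma\in\Gamma$ with $\gamma^{-1}\cdot x=x'$ and $\gamma\cdot\rho\overset{\pi(x)}{\longleftrightarrow}\rho$. $R$ is the restriction of $R_{cl}$ to $X_\infty\times X_\infty$. Properties. A (vertex) property is a Borel function $P:X\times V\to\{\text{true},\text{false}\}$ invariant under the diagonal action of $\Gamma$. For $W\subset V$: $P^+(x,W)$ means $\forall v\in W,\ P(x,v)$; $P^-(x,W)$ means $\forall v\in W,\ \lnot P(x,v)$; $P^\pm(x,W)$ means $P^+(x,W)$ or $P^-(x,W)$. A rerooting is a Borel map $\alpha:X\times V\to V$, $(x,v)\mapsto u^\alpha_{x,v}$, $\Gamma$-equivariant for the diagonal action on $X\times V$, with $u^\alpha_{x,v}\overset{\pi(x)}{\longleftrightarrow}v$ for all $(x,v)$. A sequence $(P_n)$ of vertex properties is a $\mathbb{P}$-asymptotic cluster property if for every rerooting $\alpha$ and every $v\in V$, $\mathbb{P}[\{x: P_n(x,v)\Leftrightarrow P_n(x,u^\alpha_{x,v})\}]\to1$ as $n\to\infty$. Strong Indistinguishability Property: for every $\mathbb{P}$-asymptotic cluster property $(P_n)$ and every finite $F\subset V$, $\mathbb{P}[P_n^\pm(x,V_\infty^\pi(x)\cap F)]\to1$ as $n\to\infty$. Strong ergodicity. A measure-preserving action $\Gamma\curvearrowright(Y,\mu)$ is strongly ergodic if every sequence $(B_n)$ of Borel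 subsets of $Y$ with $\mu((\gamma\cdot B_n)\triangle B_n)\to0$ for all $\gamma\in\Gamma$ satisfies $\mu(B_n)(1-\mu(B_n))\to0$. For a measure-preserving countable Borel equivalence relation $Q$ on $(Y,\mu)$, $[Q]$ is the group of Borel automorphisms of $Y$ whose graph is included in $Q$; $(B_n)$ is asymptotically $Q$-invariant if $\mu(\phi(B_n)\triangle B_n)\to0$ for all $\phi\in[Q]$; $Q$ is $\mu$-strongly ergodic if every asymptotically $Q$-invariant sequence $(B_n)$ of Borel subsets satisfies $\mu(B_n)(1-\mu(B_n))\to0$. *)

(* Defs.v *)
From HB Require Import structures.
From Stdlib Require Import Relation_Operators.
From mathcomp Require Import all_boot all_order all_algebra.
From mathcomp Require Import all_classical all_reals all_analysis.

Set Implicit Arguments.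
Unset Strict Implicit.
Unset Printing Implicit Defensive.

Import Order.TTheory GRing.Theory Num.Theory.

Local Open Scope classical_set_scope.
Local Open Scope ereal_scope.

(* A countable group with the Borel sigma-algebra of its discrete topology,
   i.e. all subsets.  The vertex set of the Cayley graph is the group itself,
   on which the group acts by left multiplication. *)
Definition discr (G : groupType) : Type := G.

HB.instance Definition _ (G : groupType) := Choice.on (discr G).
HB.instance Definition _ (G : groupType) := isPointed.Build (discr G) (1%g : G).
HB.instance Definition _ (G : groupType) :=
  @isMeasurable.Build default_measure_display (discr G)
    (discrete_measurable (T := discr G)) discrete_measurable0
    discrete_measurableC discrete_measurableU.

Section CayleyGraph.
Variables (G : groupType) (S : set G).

Definition generates : Prop :=
  forall H : set G, H 1%g ->
    (forall g h, H g -> H h -> H (g * h)%g) ->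
    (forall g, H g -> H (g^-1)%g) ->
    S `<=` H -> H = setT.

(* Edges are unordered pairs {g, gs} (a loop {g} when s = 1). *)
Definition edges : set (set G) :=
  [set e | exists g s, S s /\ e = [set g; (g * s)%g]].

Definition edge : choiceType := set_type edges.

Lemma edges_translate (g : G) (e : set G) :
  edges e -> edges [set (g * v)%g | v in e].
Proof.
move=> [h [s [Ss ->]]]; exists (g * h)%g, s; split => //.
by rewrite image_setU !image_set1 mulgA.
Qed.

Definition edge_act (g : G) (e : edge) : edge :=
  SigSub (mem_set (edges_translate g (set_valP e))).

Definition config_space : topologicalType :=
  prod_topology (fun _ : edge => bool).

Definition config : Type := edge -> bool.

Definition config_act (g : G) (w : config) : config :=
  fun e => w (edge_act g^-1%g e).

Definition open_adj (w : config) (u v : G) : Prop :=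
  exists e : edge, w e = true /\ set_val e = [set u; v].

Definition connected_in (w : config) : G -> G -> Prop :=
  clos_refl_trans G (open_adj w).

Definition cluster (w : config) (v : G) : set G :=
  [set u | connected_in w u v].

End CayleyGraph.

Definition separable_space (T : topologicalType) : Prop :=
  exists D : set T, countable D /\ dense D.

(* X is Borel isomorphic to a complete separable metric space: a Hausdorff
   pseudometric space is metric. *)
Definition standard_borel (R : realType) d (X : measurableType d) : Prop :=
  exists (T : completePseudoMetricType R) (f : X -> T),
    [/\ hausdorff_space T, separable_space T, bijective f &
        forall A : set X, measurable A <-> <<s @open T >> (f @` A)].

Section Action.
Variables (R : realType) (G : groupType) (d : measure_display).
Variables (X : measurableType d) (P : probability X R).

Definition atom (A : set X) : Prop :=
  [/\ measurable A, 0 < P A &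
      forall B, measurable B -> B `<=` A -> P B < P A -> P B = 0].

Definition atomless : Prop := forall A, ~ atom A.

Variable act : G -> X -> X.

Definition borel_action : Prop :=
  [/\ forall x, act 1%g x = x,
      forall g h x, act (g * h)%g x = act g (act h x) &
      measurable_fun [set: discr G * X] (fun p : discr G * X => act p.1 p.2)].

Definition preserves_measure : Prop :=
  forall g A, measurable A -> P (act g @^-1` A) = P A.

Definition strongly_ergodic_action : Prop :=
  forall B : nat -> set X, (forall n, measurable (B n)) ->
    (forall g, P ((act g @` B n) `+` B n) @[n --> \oo] --> 0) ->
    P (B n) * (1 - P (B n)) @[n --> \oo] --> 0.

End Action.

(* Strong ergodicity of a countable Borel equivalence relation Q on a Borel
   subset Y of X, for a measure mu on Y.  Elements of the full group [Q] are
   represented by maps X -> X of which only the restriction to Y matters. *)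
Section Relation.
Variables (R : realType) (d : measure_display) (X : measurableType d).
Variables (Y : set X) (mu : set X -> \bar R) (Q : X -> X -> Prop).

Definition borel_automorphism (phi : X -> X) : Prop :=
  [/\ set_bij Y Y phi, measurable_fun Y phi &
      forall A, measurable A -> A `<=` Y -> measurable (phi @` A)].

Definition full_group : set (X -> X) :=
  [set phi | borel_automorphism phi /\ forall x, Y x -> Q x (phi x)].

Definition asymptotically_invariant (B : nat -> set X) : Prop :=
  forall phi, full_group phi ->
    mu ((phi @` B n) `+` B n) @[n --> \oo] --> 0.

Definition strongly_ergodic_relation : Prop :=
  forall B : nat -> set X, (forall n, measurable (B n) /\ B n `<=` Y) ->
    asymptotically_invariant B ->
    mu (B n) * (1 - mu (B n)) @[n --> \oo] --> 0.

End Relation.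

Definition normalized_restriction (R : realType) d (X : measurableType d)
    (P : probability X R) (Y : set X) : set X -> \bar R :=
  fun A => P (A `&` Y) * (fine (P Y))^-1%:E.

Section Percolation.
Variables (R : realType) (G : groupType) (S : set G) (rho : G).
Variables (d : measure_display) (X : measurableType d) (P : probability X R).
Variables (act : G -> X -> X) (perc : X -> config S).

Definition generalized_percolation : Prop :=
  [/\ standard_borel R X /\ atomless P,
      borel_action act,
      preserves_measure P act,
      measurable_fun [set: X]
        (perc : X -> g_sigma_algebraType (@open (config_space S))) &
      forall g x, perc (act g x) = config_act g (perc x)].

Definition V_inf (x : X) : set G :=
  [set v | infinite_set (cluster (perc x) v)].

Definition X_inf : set X := [set x | infinite_set (cluster (perc x) rho)].

Definition R_cl (x x' : X) : Prop :=
  exists g, act g^-1%g x = x' /\ connected_in (perc x) (g * rho)%g rho.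

Definition R_inf (x x' : X) : Prop := [/\ X_inf x, X_inf x' & R_cl x x'].

Definition vertex_property (p : X * discr G -> bool) : Prop :=
  measurable_fun setT p /\
  forall g x (v : G), p (act g x, (g * v)%g) = p (x, v).

Definition rerooting (alpha : X * discr G -> discr G) : Prop :=
  [/\ measurable_fun setT alpha,
      forall g x (v : G),
        alpha (act g x, (g * v)%g) = (g * (alpha (x, v) : G))%g &
      forall x v, connected_in (perc x) (alpha (x, v)) v].

Definition asymptotic_cluster_property
    (p : nat -> X * discr G -> bool) : Prop :=
  (forall n, vertex_property (p n)) /\
  forall alpha, rerooting alpha -> forall v : G,
    P [set x | p n (x, v) <-> p n (x, alpha (x, v))] @[n --> \oo] --> 1.

Definition prop_plus (p : X * discr G -> bool) (x : X) (W : set G) : Prop :=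
  forall v, W v -> p (x, v).

Definition prop_minus (p : X * discr G -> bool) (x : X) (W : set G) : Prop :=
  forall v, W v -> ~ p (x, v).

Definition prop_pm (p : X * discr G -> bool) (x : X) (W : set G) : Prop :=
  prop_plus p x W \/ prop_minus p x W.

Definition strong_indistinguishability : Prop :=
  forall p, asymptotic_cluster_property p ->
  forall F : set G, finite_set F ->
    P [set x | prop_pm (p n) x (V_inf x `&` F)] @[n --> \oo] --> 1.

End Percolation.

(* Main.v *)
From Stdlib Require Import Relation_Operators.
Require Import Defs.
From mathcomp Require Import all_boot all_order all_algebra.
From mathcomp Require Import all_classical all_reals all_analysis.
From mathcomp Require Import ring lra.

Set Implicit Arguments.
Unset Strict Implicit.
Unset Printing Implicit Defensive.

Import Order.TTheory GRing.Theory Num.Theory.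
Import numFieldNormedType.Exports.

Local Open Scope classical_set_scope.
Local Open Scope ereal_scope.

(** A vertex property is determined by its value at the root: [p (x, v)] is
    its value at [rho] for the translate of [x] by the group element that
    takes [v] to [rho].  Hence properties correspond to Borel subsets of [X],
    rerootings to Borel maps that move each point inside its [R_cl]-class, and
    everything can be read off from the disagreement events
    [{x | Z x u v /\ p n (x, u) != p n (x, v)}] for fixed vertices [u], [v].

    Three conditions are rephrased as the vanishing of the probabilities of
    such events.
    - With [Z] meaning that [u] and [v] are connected, one gets the asymptotic
      cluster properties ([asymptotic_cluster_propertyP]).
    - With the same [Z], one gets the asymptotic invariance under the full
      group of the associated sets
      ([asymptotically_invariant_constant] and
      [constant_asymptotically_invariant]).
      A full group element sends each point to its translate by one of
      countably many group elements, and conversely the translation that moves the root from [rho] to a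
      connected [u] is covered, off its fixed points, by countably many swaps
      of a Borel set with its disjoint translate; each swap is in the full
      group.
    - With [Z] meaning that [u] and [v] both lie in infinite clusters, one
      gets the conclusion of strong indistinguishability
      ([indistinguishableP]).
    The passage between a countable family of conditions and a single one is
    always [vanishing_cover]: on a fixed countable Borel cover, it is enough to
    control an event piece by piece.

    If [R_inf] is strongly ergodic, the set [B n] of points of [X_inf] where
    [p n] holds at the root has either small measure or small complement in
    [X_inf].  By invariance of the measure the same dichotomy holds at every
    vertex, so two given vertices in infinite clusters rarely disagree.

    Conversely, let [B n] be asymptotically [R_inf]-invariant, and [p n] the
    associated property.  By indistinguishability its value at a vertex of
    [V_inf] hardly depends on that vertex.  So the event [first_value] that
    [p n] holds at the first vertex of [V_inf], for a fixed enumeration of the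
    group, is asymptotically invariant under the whole group although the
    enumeration is not equivariant.  Strong ergodicity of the action makes
    it trivial in the limit, and it asymptotically coincides with [B n] on
    [X_inf]. *)

(** * Countable quantifiers and measurability *)

Section CountableQuantifiers.
Context d (X : measurableType d) (I : Type).
Hypothesis cI : countable [set: I].

Lemma measurable_ex (F : I -> set X) :
  (forall i, measurable (F i)) -> measurable [set x | exists i, F i x].
Proof.
move=> mF; rewrite (_ : [set x | _] = \bigcup_i F i).
  exact: countable_bigcupT_measurable.
by apply/seteqP; split=> x [i]; [exists i | move=> _ Fx; exists i].
Qed.

Lemma measurable_all (F : I -> set X) :
  (forall i, measurable (F i)) -> measurable [set x | forall i, F i x].
Proof.
move=> mF; rewrite (_ : [set x | _] = ~` [set x | exists i, (~` F i) x]).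
  by apply/measurableC/measurable_ex => i; exact/measurableC.
apply/seteqP; split=> x /=; first by move=> Fx [i]; exact.
by move=> nF i; apply: contrapT => Fx; apply: nF; exists i.
Qed.

End CountableQuantifiers.

Lemma measurable_setprop d (X : measurableType d) (Q : Prop) :
  measurable [set _ : X | Q].
Proof.
have [q|nq] := pselect Q.
  by rewrite (_ : [set _ | _] = setT) //; apply/seteqP; split.
by rewrite (_ : [set _ | _] = set0) //; apply/seteqP; split.
Qed.

Lemma measurable_neqb d (X : measurableType d) (f g : X -> bool) :
  measurable_fun setT f -> measurable_fun setT g ->
  measurable [set x | f x != g x].
Proof.
move=> mf mg.
have mtrue (h : X -> bool) : measurable_fun setT h ->
    measurable [set x : X | h x].
  by move=> mh; rewrite -[X in measurable X]setTI; exact: (mh _ [set true]).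
rewrite (_ : [set x | _] = ([set x | f x] `\` [set x | g x]) `|`
  ([set x | g x] `\` [set x | f x])).
  by apply: measurableU; apply: measurableD; exact: mtrue.
apply/seteqP; split=> x /=; case: (f x); case: (g x) => //=; auto.
- by case=> -[].
- by case=> -[].
Qed.

(** * Events whose probability tends to zero *)

Section Vanishing.
Context (R : realType) d (X : measurableType d) (P : probability X R).
Implicit Types A B D : nat -> set X.

Definition vanishing A : Prop := P (A n) @[n --> \oo] --> 0.

Lemma fine_prob (A : set X) : measurable A -> P A = (fine (P A))%:E.
Proof. by move=> mA; rewrite fineK// fin_num_measure. Qed.

Lemma vanishingP A : (forall n, measurable (A n)) ->
  vanishing A <->
  forall eps : R, (0 < eps)%R -> \forall n \near \oo, P (A n) <= eps%:E.
Proof.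
move=> mA; split.
  move=> /fine_cvgP[_ /cvgr0_norm_le cA] eps e0.
  near=> n; have : (`|(fine \o (P \o A)) n| <= eps)%R by near: n; exact: cA.
  by rewrite /= ger0_norm ?fine_ge0// [P (A n)]fine_prob// lee_fin.
move=> small; apply/fine_cvgP; split.
  by near=> n; exact: fin_num_measure.
apply/cvgr0Pnorm_lt => eps e0; near=> n.
have : P (A n) <= (eps / 2)%:E by near: n; apply: small; rewrite divr_gt0.
rewrite /= ger0_norm ?fine_ge0// [P (A n)]fine_prob// lee_fin => /le_lt_trans.
by apply; rewrite ltr_pdivrMr// ltr_pMr// ltr1n.
Unshelve. all: by end_near. Qed.

Lemma vanishing_sub A B : (forall n, measurable (A n)) ->
  (forall n, measurable (B n)) -> (forall n, A n `<=` B n) ->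
  vanishing B -> vanishing A.
Proof.
move=> mA mB AB /(vanishingP mB) vB; apply/(vanishingP mA) => eps e0.
near=> n; apply: (@le_trans _ _ (P (B n))); last by near: n; exact: vB.
by apply: le_measure; rewrite ?inE.
Unshelve. all: by end_near. Qed.

Lemma vanishing_set0 A : (forall n, A n = set0) -> vanishing A.
Proof.
move=> A0; rewrite /vanishing (eq_cvg _ _ (_ : _ =1 fun=> 0)).
  exact: cvg_cst.
by move=> n; rewrite A0 measure0.
Qed.

Lemma vanishingU A B : (forall n, measurable (A n)) ->
  (forall n, measurable (B n)) -> vanishing A -> vanishing B ->
  vanishing (fun n => A n `|` B n).
Proof.
move=> mA mB /(vanishingP mA) vA /(vanishingP mB) vB.
have mAB n : measurable (A n `|` B n) by exact: measurableU.
apply/(vanishingP mAB) => eps e0; near=> n.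
apply: (@le_trans _ _ (P (A n) + P (B n))); first exact: measureU2.
rewrite (splitr eps) EFinD; apply: leeD; near: n.
  by apply: vA; rewrite divr_gt0.
by apply: vB; rewrite divr_gt0.
Unshelve. all: by end_near. Qed.

Lemma vanishing_setC A : (forall n, measurable (A n)) ->
  P (A n) @[n --> \oo] --> 1 <-> vanishing (fun n => ~` A n).
Proof.
move=> mA; split=> cA.
  suff : 1 - P (A n) @[n --> \oo] --> 1 - 1.
    by rewrite subee// /vanishing; under eq_fun do rewrite -probability_setC//.
  by apply: cvgeB => //; exact: cvg_cst.
have eA n : 1 - P (~` A n) = P (A n).
  by rewrite -probability_setC ?setCK//; exact: measurableC.
suff : 1 - P (~` A n) @[n --> \oo] --> 1 - 0.
  by rewrite sube0; under eq_fun do rewrite eA.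
by apply: cvgeB => //; exact: cvg_cst.
Qed.

Lemma vanishing_preim (f : X -> X) A :
  (forall C : set X, measurable C -> P (f @^-1` C) = P C) ->
  (forall n, measurable (A n)) ->
  vanishing A -> vanishing (fun n => f @^-1` A n).
Proof.
move=> mf mA; have e n : P (f @^-1` A n) = P (A n) by exact: mf.
by rewrite /vanishing (eq_cvg _ _ e).
Qed.

(** Continuity from above: the part of [D n] outside the first [k]
    sets of the cover has probability at most that of [V k], which does not
    depend on [n] and decreases to zero. *)
Lemma vanishing_cover_nat (E : nat -> set X) D :
  (forall k, measurable (E k)) -> (forall n, measurable (D n)) ->
  (forall n, D n `<=` [set x | exists k, E k x]) ->
  (forall k, vanishing (fun n => E k `&` D n)) -> vanishing D.
Proof.
move=> mE mD DE vED.
pose U k := \big[setU/set0]_(i < k) E i.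
pose V k := ~` U k `&` [set x | exists k, E k x].
have mU k : measurable (U k) by exact: bigsetU_measurable.
have mEx : measurable [set x | exists k, E k x] by exact: measurable_ex.
have mV k : measurable (V k) by apply: measurableI => //; exact: measurableC.
have vV : vanishing V.
  have V0 : \bigcap_k V k = set0.
    apply/seteqP; split=> // x Vx; have [_ [k Ek]] := Vx 0%N I.
    have [+ _] := Vx k.+1 I; apply.
    by rewrite /U big_ord_recr /=; right.
  suff : P \o V @ \oo --> P (\bigcap_k V k) by rewrite V0 measure0.
  apply: nonincreasing_cvg_mu => //.
  - by rewrite ltey_eq fin_num_measure.
  - exact: bigcapT_measurable.
  apply/nonincreasing_seqP => k; apply/subsetPset => x [nU Ex]; split => //.
  by apply: contra_not nU => Ux; rewrite /U big_ord_recr /=; left.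
have vUD k : vanishing (fun n => U k `&` D n).
  elim: k => [|k IHk].
    by apply: vanishing_set0 => n; rewrite /U big_ord0 set0I.
  have UD n : U k.+1 `&` D n = (U k `&` D n) `|` (E k `&` D n).
    by rewrite /U big_ord_recr /= setIUl.
  rewrite (funext UD).
  by apply: vanishingU => // n; exact: measurableI.
apply/(vanishingP mD) => eps e0; have e20 : (0 < eps / 2)%R by rewrite divr_gt0.
have /(vanishingP mV) /(_ _ e20) [K _ /(_ K (leqnn K)) /= VK] := vV.
have mUD n : measurable (U K `&` D n) by exact: measurableI.
near=> n.
apply: (@le_trans _ _ (P (U K `&` D n) + P (V K))).
  apply: (@le_trans _ _ (P ((U K `&` D n) `|` V K))); last exact: measureU2.
  apply: le_measure; rewrite ?inE//; first exact: measurableU.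
  move=> x Dx; have [Ux|nUx] := pselect (U K x); [by left | right].
  by split => //; exact: DE Dx.
rewrite (splitr eps) EFinD; apply: leeD => //; near: n.
exact: (vanishingP mUD).1.
Unshelve. all: by end_near. Qed.

(** The main tool: the cover is fixed while [n] grows, so that no uniformity of
    the convergence over its pieces is required. *)
Lemma vanishing_cover (I : Type) (E : I -> set X) D :
  countable [set: I] ->
  (forall i, measurable (E i)) -> (forall n, measurable (D n)) ->
  (forall n, D n `<=` [set x | exists i, E i x]) ->
  (forall i, vanishing (fun n => E i `&` D n)) -> vanishing D.
Proof.
move=> cI mE mD DE vED.
have /countable_injP [f injf] := cI.
pose E' k := [set x | exists i, f i = k /\ E i x].
have E'f i : E' (f i) = E i.
  apply/seteqP; split=> x /=; last by exists i.
  by case=> j [fji]; have -> : j = i by apply: injf; rewrite ?inE.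
have E'0 k : (forall i, f i <> k) -> E' k = set0.
  by move=> nk; apply/seteqP; split=> // x [i [/nk]].
apply: (@vanishing_cover_nat E') => // [k|n x /DE [i Ei]|k].
- have [[i <-]|ne] := pselect (exists i, f i = k); first by rewrite E'f.
  by rewrite E'0// => i fi; apply: ne; exists i.
- by exists (f i); rewrite E'f.
- have [[i <-]|ne] := pselect (exists i, f i = k); first by rewrite E'f.
  rewrite E'0; last by move=> i fi; apply: ne; exists i.
  by apply: vanishing_set0 => n; rewrite set0I.
Qed.

Lemma measurable_exseq (I : eqType) (l : seq I) (A : I -> set X) :
  (forall i, measurable (A i)) ->
  measurable [set x | exists2 i, i \in l & A i x].
Proof.
move=> mA; elim: l => [|j l IHl].
  by rewrite (_ : [set x | _] = set0)//; apply/seteqP; split=> // x [].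
rewrite (_ : [set x | _] = A j `|` [set x | exists2 i, i \in l & A i x]).
  exact: measurableU.
apply/seteqP; split=> x /=.
  by move=> [i]; rewrite inE => /orP[/eqP -> ?|il Ai]; [left|right; exists i].
move=> [Aj|[i il Ai]]; first by exists j; rewrite ?mem_head.
by exists i => //; rewrite inE il orbT.
Qed.

Lemma vanishing_seq (I : eqType) (l : seq I) (A : I -> nat -> set X) :
  (forall i n, measurable (A i n)) -> (forall i, vanishing (A i)) ->
  vanishing (fun n => [set x | exists2 i, i \in l & A i n x]).
Proof.
move=> mA vA; elim: l => [|j l IHl].
  by apply: vanishing_set0 => n; apply/seteqP; split=> // x [].
apply: vanishing_sub (vanishingU _ _ (vA j) IHl) => // n.
- exact: measurable_exseq.
- by apply: measurableU => //; exact: measurable_exseq.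
- move=> x [i]; rewrite inE => /orP[/eqP -> ?|il Ai]; [left|right] => //.
  by exists i.
- exact: measurable_exseq.
Qed.

End Vanishing.

(** * Separation of points in standard Borel spaces *)

(** The separation is oriented, from [x] to [y], so that a point [x] moved to
    [y] lies in a set of the sequence that [y] avoids. *)
Definition separating d (X : measurableType d) (A : nat -> set X) : Prop :=
  (forall k, measurable (A k)) /\
  forall x y, x <> y -> exists k, A k x /\ ~ A k y.

(** Small balls around a countable dense set separate the points of a separable
    metric space.  Interiors are taken since the balls of a pseudometric
    structure may fail to be open. *)
Lemma standard_borel_separating (R : realType) d (X : measurableType d) :
  standard_borel R X -> exists A : nat -> set X, separating A.
Proof.
move=> [T [f [hausT [D [/countable_injP[c cinj] dD]] bijf mX]]].
pose r (m : nat) : R := m.+1%:R^-1%R.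
have r0 m : (0 < r m)%R by rewrite invr_gt0.
have ctr (t : T) eps : (0 < eps)%R -> (ball t eps)° t.
  by move=> e0; apply: nbhs_singleton; apply: nbhs_interior; exact: nbhsx_ballx.
pose O (i : nat * nat) : set T :=
  \bigcup_(t in D `&` [set t | c t = i.1]) (ball t (r i.2))°.
have oO i : open (O i).
  by apply: bigcup_open => t _; exact: open_interior.
(* The code of a pair gives the index of a dense point and a radius. *)
exists (fun k => if unpickle k is Some i then f @^-1` O i else set0); split.
  move=> k; case: unpickle => // i; apply/mX.
  rewrite image_preimage; first exact: sub_sigma_algebra.
  apply/seteqP; split=> // t _; have [f' _ f'K] := bijf.
  by exists (f' t).
move=> x y xy.
have fxy : f x != f y by apply/eqP => /(bij_inj bijf).
have := hausT; rewrite ball_hausdorff => /(_ _ _ fxy)[[e e'] /= /eqP ee'].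
have e20 : (0 < e%:num / 2)%R by rewrite divr_gt0.
have [m _ /(_ m (leqnn m)) /= me] := near_infty_natSinv_lt (PosNum e20).
have r20 : (0 < r m / 2)%R by rewrite divr_gt0.
have [] := dD (ball (f x) (r m / 2))°.
- by exists (f x); exact: ctr.
- exact: open_interior.
move=> t [/interior_subset xt Dt].
exists (pickle (c t, m)); rewrite pickleK; split.
  exists t => //; rewrite /interior.
  apply: filterS (nbhsx_ballx (f x) _ r20) => z xz.
  by rewrite [r m]splitr; apply: ball_triangle xz; exact: ball_sym.
move=> [s [Ds /= cs] /interior_subset sy].
have st : s = t by apply: cinj; rewrite ?inE.
have : (ball (f x) e%:num `&` ball (f y) e'%:num) (f y).
  split; last exact: ballxx.
  apply: (@le_ball _ _ _ (r m / 2 + r m)%R).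
    by move: me; rewrite /= -/(r m); move: (r0 m); lra.
  by apply: ball_triangle xt _; rewrite -st.
by rewrite ee'.
Qed.

(** * Smallness of a set or of its complement *)

Section RealSequences.
Variable R : realType.
Implicit Types a b : nat -> R.

Lemma cvg_EFin0 a : (a n)%:E @[n --> \oo] --> 0 <-> (a @ \oo --> (0 : R)%R).
Proof.
split; first by move=> /fine_cvgP[_].
by move=> a0; apply/fine_cvgP; split=> //; near=> n.
Unshelve. all: by end_near. Qed.

Lemma cvg0_le a b : (forall n, 0 <= a n <= b n)%R ->
  b @ \oo --> (0 : R)%R -> a @ \oo --> (0 : R)%R.
Proof.
move=> ab; apply: squeeze_cvgr; last exact: cvg_cst.
by near=> n.
Unshelve. all: by end_near. Qed.

Lemma cvg0_sqr a : (fun n => a n ^+ 2)%R @ \oo --> (0 : R)%R ->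
  a @ \oo --> (0 : R)%R.
Proof.
move=> /cvgr0Pnorm_lt a2; apply/cvgr0Pnorm_lt => eps e0; near=> n.
have : (`|a n ^+ 2| < eps ^+ 2)%R by near: n; apply: a2; rewrite exprn_gt0.
by rewrite normrX ltr_pXn2r// nnegrE// ltW.
Unshelve. all: by end_near. Qed.

Lemma cvg0_scale (k : R) a : (k != 0)%R ->
  (fun n => k * a n)%R @ \oo --> (0 : R)%R <-> a @ \oo --> (0 : R)%R.
Proof.
move=> k0; split=> [ka|a0]; last first.
  by rewrite -(mulr0 k); apply: cvgMl_tmp.
rewrite -(mulr0 (k^-1)%R) (funext (fun n => esym (mulKf k0 (a n)))).
exact: cvgMl_tmp.
Qed.

End RealSequences.

Section Dichotomy.
Context (R : realType) d (X : measurableType d) (P : probability X R).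
Local Notation m A := (fine (P A)).

Lemma fine_prob_setD (Y B : set X) : measurable Y -> measurable B -> B `<=` Y ->
  m (Y `\` B) = (m Y - m B)%R.
Proof.
move=> mY mB BY; rewrite measureD//; last by rewrite ltey_eq fin_num_measure.
by rewrite setIidr// fineB ?fin_num_measure.
Qed.

Lemma fine_prob_le (A B : set X) : measurable A -> measurable B -> A `<=` B ->
  (m A <= m B)%R.
Proof.
by move=> mA mB AB; apply: fine_le; rewrite ?fin_num_measure ?le_measure ?inE.
Qed.

Lemma fine_probU (A B : set X) : measurable A -> measurable B ->
  (m (A `|` B) <= m A + m B)%R.
Proof.
move=> mA mB; rewrite -fineD ?fin_num_measure//.
apply: fine_le; rewrite ?fin_numD ?fin_num_measure ?measureU2//.
exact: measurableU.
Qed.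

Lemma fine_prob_le1 (A : set X) : measurable A -> (m A <= 1)%R.
Proof. by move=> mA; rewrite -lee_fin -fine_prob// probability_le1. Qed.

Lemma vanishing_fine A : (forall n, measurable (A n)) ->
  vanishing P A <-> (fun n => m (A n)) @ \oo --> (0 : R)%R.
Proof.
move=> mA; rewrite -cvg_EFin0 /vanishing.
by rewrite (eq_cvg _ _ (fun n => fine_prob P (mA n))).
Qed.

Lemma cvg_prob_dichotomy B : (forall n, measurable (B n)) ->
  P (B n) * (1 - P (B n)) @[n --> \oo] --> 0 <->
  (fun n => m (B n) * m (~` B n))%R @ \oo --> (0 : R)%R.
Proof.
move=> mB; rewrite -cvg_EFin0.
rewrite (eq_cvg _ _ (g := fun n => (m (B n) * m (~` B n))%:E))// => n.
rewrite -probability_setC// {1}(fine_prob P (mB n)).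
by rewrite (fine_prob P (measurableC (mB n))) EFinM.
Qed.

(** The factors [B n] and [Y `\` B n] are symmetric, which spares every later
    argument the passage to subsequences along which one of them vanishes. *)
Lemma cvg_normalized_dichotomy Y B : measurable Y -> 0 < P Y ->
  (forall n, measurable (B n) /\ B n `<=` Y) ->
  normalized_restriction P Y (B n) * (1 - normalized_restriction P Y (B n))
    @[n --> \oo] --> 0 <->
  (fun n => m (B n) * m (Y `\` B n))%R @ \oo --> (0 : R)%R.
Proof.
move=> mY Y0 mB; have y0 : (0 < m Y)%R by rewrite -lte_fin -fine_prob.
rewrite (eq_cvg _ _ (g := fun n =>
  ((m Y)^-1 ^+ 2 * (m (B n) * m (Y `\` B n)))%:E)); last first.
  move=> n; have [mBn BY] := mB n.
  rewrite /normalized_restriction setIidl// {1 2}(fine_prob P mBn).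
  rewrite -!EFinM fine_prob_setD//; congr EFin.
  by field; rewrite gt_eqF.
by rewrite cvg_EFin0; apply: cvg0_scale; rewrite gt_eqF// exprn_gt0// invr_gt0.
Qed.

Lemma cvg_normalized Y A : measurable Y -> 0 < P Y ->
  (forall n, measurable (A n)) ->
  normalized_restriction P Y (A n) @[n --> \oo] --> 0 <->
  vanishing P (fun n => A n `&` Y).
Proof.
move=> mY Y0 mA; have y0 : (0 < m Y)%R by rewrite -lte_fin -fine_prob.
have mAY n : measurable (A n `&` Y) by exact: measurableI.
rewrite (vanishing_fine mAY) (eq_cvg _ _ (g := fun n =>
  ((m Y)^-1 * m (A n `&` Y))%:E)); last first.
  by move=> n; rewrite /normalized_restriction fine_prob// -EFinM mulrC.
by rewrite cvg_EFin0; apply: cvg0_scale; rewrite gt_eqF// invr_gt0.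
Qed.

End Dichotomy.

(** * Enumeration of a finitely generated group *)

(** The values of words in the generators and their inverses form a subgroup,
    and words are countably many. *)
Lemma generates_enum (G : groupType) (S : set G) :
  finite_set S -> generates S -> exists e : nat -> G, range e = setT.
Proof.
move=> /finite_seqP[l Sl] genS.
pose letter (k : nat * bool) : G :=
  if k.2 then nth 1%g l k.1 else (nth 1%g l k.1)^-1%g.
pose ev (w : seq (nat * bool)) : G := foldr (fun k g => letter k * g)%g 1%g w.
have evC v w : (ev (v ++ w) = ev v * ev w)%g.
  by elim: v => [|k v IHv] /=; rewrite ?mul1g// IHv mulgA.
have letterV k : exists k', letter k' = (letter k)^-1%g.
  exists (k.1, ~~ k.2); rewrite /letter /=; case: k.2 => //=.
  by rewrite invgK.
have evV w : exists w', ev w' = (ev w)^-1%g.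
  elim: w => [|k w [w' IHw]] /=; first by exists [::]; rewrite /= invg1.
  have [k' kV] := letterV k.
  by exists (w' ++ [:: k']); rewrite evC IHw /= kV mulg1 invgM.
have evT : range ev = setT.
  apply: genS.
  - by exists [::].
  - by move=> _ _ [v _ <-] [w _ <-]; exists (v ++ w).
  - by move=> _ [w _ <-]; have [w' <-] := evV w; exists w'.
  - move=> s; rewrite Sl /= => ls; exists [:: (index s l, true)] => //=.
    by rewrite /letter /= nth_index// mulg1.
exists (fun n => oapp ev 1%g (unpickle n)).
apply/seteqP; split=> // g _; have [w _ <-] : range ev g by rewrite evT.
by exists (pickle w) => //; rewrite pickleK.
Qed.

Lemma countable_range T (e : nat -> T) : range e = setT -> countable [set: T].
Proof. by move=> <-; apply: card_le_trans (card_image_le _ _) _. Qed.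

(** * Clusters and the group action *)

Section Percolation.
Context (R : realType) (G : groupType) (S : set G) (rho : G).
Context d (X : measurableType d) (P : probability X R).
Variables (act : G -> X -> X) (perc : X -> config S).
Hypothesis act1 : forall x, act 1%g x = x.
Hypothesis actM : forall g h x, act (g * h)%g x = act g (act h x).
Hypothesis mact2 :
  measurable_fun [set: discr G * X] (fun p : discr G * X => act p.1 p.2).
Hypothesis actP : preserves_measure P act.
Hypothesis mperc : measurable_fun [set: X]
  (perc : X -> g_sigma_algebraType (@open (config_space S))).
Hypothesis percA : forall g x, perc (act g x) = config_act g (perc x).
Variable e : nat -> G.
Hypothesis eT : range e = setT.

Let cG : countable [set: G]. Proof. exact: countable_range eT. Qed.

Local Notation connected x u v := (connected_in (perc x) u v).

Lemma actK g x : act g^-1%g (act g x) = x.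
Proof. by rewrite -actM mulVg act1. Qed.

Lemma actVK g x : act g (act g^-1%g x) = x.
Proof. by rewrite -actM mulgV act1. Qed.

Lemma measurable_act g : measurable_fun setT (act g).
Proof. exact: (measurable_fun_pair2 (g : discr G) mact2). Qed.

Lemma measurable_act_preim g A : measurable A -> measurable (act g @^-1` A).
Proof. by move=> mA; rewrite -[_ @^-1` _]setTI; exact: measurable_act. Qed.

Lemma image_act g A : act g @` A = act g^-1%g @^-1` A.
Proof.
apply/seteqP; split=> x /=; first by case=> y Ay <-; rewrite actK.
by move=> Ax; exists (act g^-1%g x) => //; rewrite actVK.
Qed.

Lemma vanishing_act g A : (forall n, measurable (A n)) ->
  vanishing P A -> vanishing P (fun n => act g @^-1` A n).
Proof. by move=> mA; apply: vanishing_preim => // B; exact: actP. Qed.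

Lemma open_adj_act g w u v :
  open_adj w u v -> open_adj (S := S) (config_act g w) (g * u)%g (g * v)%g.
Proof.
move=> [b [wb bE]]; exists (edge_act g b); split.
  rewrite /config_act; have -> // : edge_act g^-1%g (edge_act g b) = b.
  apply/val_inj/seteqP; split=> h /=.
    by case=> _ [k bk <-] <-; rewrite mulKg.
  by move=> bh; exists (g * h)%g; [exists h|rewrite mulKg].
have -> : set_val (edge_act g b) = [set (g * h)%g | h in set_val b] by [].
by rewrite bE image_setU !image_set1.
Qed.

Lemma connected_act_imp g x u v :
  connected x u v -> connected (act g x) (g * u)%g (g * v)%g.
Proof.
elim=> [{}u {}v uv|{}u|{}u z {}v _ uz _ zv].
- by apply: rt_step; rewrite percA; exact: open_adj_act.
- exact: rt_refl.
- exact: rt_trans uz zv.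
Qed.

Lemma connected_act g x u v :
  connected (act g x) (g * u)%g (g * v)%g <-> connected x u v.
Proof.
split; last exact: connected_act_imp.
by move=> /(connected_act_imp g^-1%g); rewrite actK !mulKg.
Qed.

Lemma connected_sym x u v : connected x u v -> connected x v u.
Proof.
elim=> [{}u {}v [b [xb bE]]|{}u|{}u z {}v _ uz _ zv].
- by apply: rt_step; exists b; split=> //; rewrite setUC.
- exact: rt_refl.
- exact: rt_trans zv uz.
Qed.

Lemma V_inf_act_imp g x v : V_inf perc x v -> V_inf perc (act g x) (g * v)%g.
Proof.
rewrite /V_inf /= => infv fing; apply: infv.
apply: sub_finite_set (finite_image (fun u => g^-1 * u)%g fing).
move=> u uv; exists (g * u)%g; last by rewrite mulKg.
exact: connected_act_imp.
Qed.

Lemma V_inf_act g x v : V_inf perc (act g x) (g * v)%g <-> V_inf perc x v.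
Proof.
split; last exact: V_inf_act_imp.
by move=> /(@V_inf_act_imp g^-1%g); rewrite actK mulKg.
Qed.

Lemma V_inf_connected x u v :
  connected x u v -> V_inf perc x u -> V_inf perc x v.
Proof.
move=> uv infu finv; apply: infu; apply: sub_finite_set finv => z zu.
exact: rt_trans zu uv.
Qed.

(** Only the coordinate of the edge between [u] and [v], if there is one, is
    involved, and the coordinates of [config_space] are continuous. *)
Lemma measurable_open_adj u v : measurable [set x | open_adj (perc x) u v].
Proof.
have [uvS|nuv] := pselect (edges S [set u; v]); last first.
  rewrite (_ : [set x | _] = set0) //; apply/seteqP; split=> // x [b [_ bE]].
  by apply: nuv; rewrite -bE; exact: set_valP.
pose b : edge S := SigSub (mem_set uvS).
rewrite (_ : [set x | _] = setT `&` perc @^-1` [set w | w b = true]);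
  last first.
  rewrite setTI; apply/seteqP; split=> x /=; last by exists b.
  by move=> [b' [xb' b'E]]; have <- : b' = b by exact/val_inj.
apply: mperc => //; apply: sub_sigma_algebra.
apply: (@open_comp (config_space S) bool (fun w => w b) [set true]).
  by move=> w _; exact: (@proj_continuous (edge S) (fun=> bool) b).
exact: discrete_open.
Qed.

(** Connectedness graded by length, so as to be a countable union of events on
    finitely many steps. *)
Fixpoint walk w n u v : Prop :=
  if n is m.+1 then exists z, open_adj (S := S) w u z /\ walk w m z v
  else u = v.

Lemma connected_walk x u v : connected x u v <-> exists n, walk (perc x) n u v.
Proof.
split.
  elim=> [{}u {}v uv|{}u|{}u z {}v _ [n uz] _ [m zv]].
  - by exists 1%N, v.
  - by exists 0%N.
  - exists (n + m)%N; elim: n u uz => [|n IHn] u /=; first by move=> ->.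
    by move=> [t [ut /IHn tv]]; exists t.
move=> [n]; elim: n u => [|n IHn] u /=; first by move=> ->; exact: rt_refl.
by move=> [z [uz /IHn]]; apply: rt_trans; exact: rt_step.
Qed.

Lemma measurable_connected u v : measurable [set x | connected x u v].
Proof.
under eq_set do rewrite (propext (connected_walk _ _ _)).
apply: measurable_ex => // n; elim: n u => [|n IHn] u /=.
  exact: measurable_setprop.
apply: measurable_ex => // z; apply: measurableI => //.
exact: measurable_open_adj.
Qed.

(** Infinite means not exhausted by any finite list; lists of indices are used
    since they form a countable type. *)
Lemma V_infE x v : V_inf perc x v <->
  forall l : seq nat, exists u, connected x u v /\ u \notin map e l.
Proof.
split=> [infv l|infv /finite_seqP[l clE]].
  apply: contrapT => nou; apply: infv.
  apply: sub_finite_set (finite_seq (map e l)) => u uv /=.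
  by apply/negP => ul; apply: nou; exists u; split => //; apply/negP.
have eV g : exists n, e n = g.
  by have [n _ <-] : range e g by [rewrite eT]; exists n.
have [f ef] := choice eV.
have [u [uv]] := infv (map f l); rewrite -map_comp map_id_in; last first.
  by move=> g _ /=.
by apply/negP/negPn; have : Defs.cluster (perc x) v u := uv; rewrite clE.
Qed.

Lemma measurable_V_inf v : measurable [set x | V_inf perc x v].
Proof.
under eq_set do rewrite (propext (V_infE _ _)).
apply: measurable_all => // l; apply: measurable_ex => // u.
by apply: measurableI; [exact: measurable_connected|exact: measurable_setprop].
Qed.

(** * Vertex properties and disagreement events *)

Lemma measurable_fun_discr d' (T : measurableType d') (f : X * discr G -> T) :
  (forall v : G, measurable_fun setT (fun x => f (x, v))) ->
  measurable_fun setT f.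
Proof.
move=> mf _ A mA; rewrite setTI.
rewrite (_ : _ @^-1` A =
  [set q | exists v : G, A (f (q.1, v)) /\ q.2 = v]); last first.
  apply/seteqP; split=> -[x v] /=; first by exists v.
  by move=> [w [Aw ->]].
apply: measurable_ex => // v; apply: measurableI.
  have := @measurable_fst _ _ X (discr G) measurableT _ (mf v measurableT _ mA).
  by rewrite !setTI.
have := @measurable_snd _ _ X (discr G) measurableT [set v : discr G] I.
by rewrite setTI.
Qed.

Section VertexProperty.
Variable p : X * discr G -> bool.
Hypothesis pP : vertex_property act p.

Lemma measurable_prop (v : G) : measurable_fun setT (fun x => p (x, v)).
Proof. exact: (measurable_fun_pair1 (v : discr G) pP.1). Qed.

(** Equivariance for the translation that takes [v] to [rho]. *)
Lemma prop_shift x v : p (act (rho * v^-1)%g x, rho) = p (x, v).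
Proof. by rewrite -{2}[rho](mulgVK v) pP.2. Qed.

Lemma measurable_prop_neq u v : measurable [set x | p (x, u) != p (x, v)].
Proof. by apply: measurable_neqb; exact: measurable_prop. Qed.

Lemma measurable_prop_pm F :
  measurable [set x | prop_pm p x (V_inf perc x `&` F)].
Proof.
have mV v : measurable [set x | (V_inf perc x `&` F) v].
  by apply: measurableI; [exact: measurable_V_inf|exact: measurable_setprop].
apply: measurableU; apply: measurable_all => // v.
  rewrite [X in measurable X](_ : _ =
    ~` [set x | (V_inf perc x `&` F) v] `|` [set x | p (x, v)]).
    apply: measurableU; first exact: measurableC.
    by rewrite -[X in measurable X]setTI; exact: measurable_prop.
  apply/seteqP; split=> x /=; last by case=> [nV /nV|].
  by move=> h; have [/h|] := pselect ((V_inf perc x `&` F) v); [right|left].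
rewrite [X in measurable X](_ : _ =
  ~` [set x | (V_inf perc x `&` F) v] `|` ~` [set x | p (x, v)]).
  apply: measurableU; first exact: measurableC.
  apply: measurableC.
  by rewrite -[X in measurable X]setTI; exact: measurable_prop.
apply/seteqP; split=> x /=; last by case=> [nV /nV|].
by move=> h; have [/h|] := pselect ((V_inf perc x `&` F) v); [right|left].
Qed.

End VertexProperty.

(** [Z x u v] is a relation between vertices depending on the configuration;
    vertices related by it should eventually agree with high probability. *)
Definition asymptotically_constant (Z : X -> G -> G -> Prop)
    (p : nat -> X * discr G -> bool) : Prop :=
  forall u v : G,
    vanishing P (fun n => [set x | Z x u v /\ p n (x, u) != p n (x, v)]).

Definition both_infinite x u v := V_inf perc x u /\ V_inf perc x v.

Section PropertySequence.
Variable p : nat -> X * discr G -> bool.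
Hypothesis pP : forall n, vertex_property act (p n).

Lemma measurable_disagree_joined u v n :
  measurable [set x | connected x u v /\ p n (x, u) != p n (x, v)].
Proof.
by apply: measurableI; [exact: measurable_connected|exact: measurable_prop_neq].
Qed.

Lemma measurable_disagree_infinite u v n :
  measurable [set x | both_infinite x u v /\ p n (x, u) != p n (x, v)].
Proof.
apply: measurableI; last exact: measurable_prop_neq.
by apply: measurableI; exact: measurable_V_inf.
Qed.

(** The events that a rerooting takes a given value at [v] form a countable
    cover of [X], and the disagreement of [v] with each value is controlled.
    Conversely, the rerooting that moves [w] by the same displacement as from
    [v] to [u], whenever this stays inside the cluster of [w], compares [v]
    with [u] only. *)
Lemma asymptotic_cluster_propertyP :
  asymptotic_cluster_property P act perc p <->
  asymptotically_constant (fun x u v => connected x u v) p.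
Proof.
have mpa alpha v n : rerooting act perc alpha ->
    measurable [set x | p n (x, v) != p n (x, alpha (x, v))].
  move=> [malpha _ _]; apply: measurable_neqb; first exact: measurable_prop.
  apply: (measurableT_comp (pP n).1); apply: measurable_fun_pair => //.
  exact: (measurable_fun_pair1 (v : discr G) malpha).
have iffE alpha v n : [set x | p n (x, v) <-> p n (x, alpha (x, v))] =
    ~` [set x | p n (x, v) != p n (x, alpha (x, v))].
  apply/seteqP; split=> x /=; last by move=> /negP/negPn/eqP ->.
  by case: (p n _); case: (p n _) => // [[]]; auto.
split.
  move=> [_ clp] u v.
  pose other (w : G) : G := (w * v^-1 * u)%g.
  pose alpha (q : X * discr G) : discr G :=
    if `[< connected q.1 (other q.2) q.2 >] then other q.2 else q.2.
  have alphaP : rerooting act perc alpha.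
    split.
    - apply: measurable_fun_discr => w; rewrite /alpha /=.
      apply: measurable_fun_ifT => //.
      apply: (@measurable_fun_bool _ _ _ _ true); rewrite setTI.
      rewrite (_ : _ @^-1` _ = [set x | connected x (other w) w]).
        exact: measurable_connected.
      by apply/seteqP; split=> x /= /asboolP.
    - move=> g x w; rewrite /alpha /=.
      have -> : other (g * w)%g = (g * other w)%g by rewrite /other !mulgA.
      by rewrite (propext (connected_act g x _ _)); case: ifP.
    - move=> x w; rewrite /alpha /=; case: ifPn => [/asboolP//|_].
      exact: rt_refl.
  have mD n : measurable [set x | p n (x, v) != p n (x, alpha (x, v))].
    exact: mpa.
  have := clp _ alphaP v; rewrite (eq_cvg _ _ (fun n => congr1 P (iffE _ _ n))).
  move=> /(vanishing_setC P (fun n => measurableC (mD n))).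
  rewrite (funext (fun n => setCK _)); apply: vanishing_sub => // n.
    exact: measurable_disagree_joined.
  move=> x [uv neq]; rewrite /alpha /= /other mulgV mul1g.
  by case: ifPn => [_|/asboolP//]; rewrite eq_sym.
move=> cst; split=> // alpha alphaP v.
rewrite (eq_cvg _ _ (fun n => congr1 P (iffE _ _ n))).
have mD n : measurable [set x | p n (x, v) != p n (x, alpha (x, v))].
  exact: mpa.
apply/(vanishing_setC P (fun n => measurableC (mD n))).
rewrite (funext (fun n => setCK _)).
have [malpha _ alphac] := alphaP.
have mE (u : G) : measurable [set x | alpha (x, v) = u].
  have := measurable_fun_pair1 (v : discr G) malpha.
  by move=> /(_ measurableT [set u : discr G] I); rewrite setTI.
apply: (vanishing_cover (E := fun u : G => [set x | alpha (x, v) = u])) => //.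
- by move=> n x _; exists (alpha (x, v)).
move=> u; apply: vanishing_sub (cst u v) => [n|n|n x [/= <-]].
- by apply: measurableI; [exact: mE|exact: mD].
- exact: measurable_disagree_joined.
- by rewrite eq_sym; split=> //; exact: alphac.
Qed.

(** If [prop_pm] fails on a finite set of vertices, two vertices of the set
    disagree, and there are finitely many pairs. *)
Lemma indistinguishableP :
  (forall F : set G, finite_set F ->
    P [set x | prop_pm (p n) x (V_inf perc x `&` F)] @[n --> \oo] --> 1) <->
  asymptotically_constant both_infinite p.
Proof.
split=> [sip u v|cst F /finite_seqP[l ->]].
  have := sip [set u; v] (finite_set2 _ _).
  move=> /(vanishing_setC P (fun n => measurable_prop_pm (pP n) _)).
  apply: vanishing_sub => n.
  - exact: measurable_disagree_infinite.
  - by apply: measurableC; exact: measurable_prop_pm.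
  - move=> x [[iu iv] /= neq] [] pm; move: neq.
      by rewrite !pm//; split=> //; [right|left].
    have /negP/negbTE -> := pm u (conj iu (or_introl erefl)).
    by have /negP/negbTE -> := pm v (conj iv (or_intror erefl)).
apply/(vanishing_setC P (fun n => measurable_prop_pm (pP n) _)).
pose A (uv : G * G) n :=
  [set x | both_infinite x uv.1 uv.2 /\ p n (x, uv.1) != p n (x, uv.2)].
have mA uv n : measurable (A uv n).
  exact: measurable_disagree_infinite.
have := vanishing_seq [seq (u, v) | u <- l, v <- l] mA
  (fun uv => cst uv.1 uv.2).
apply: vanishing_sub => // n.
- by apply: measurableC; exact: measurable_prop_pm.
- by apply: measurable_exseq.
move=> x npm; apply: contrapT => nA; apply: npm.
have agree u v :
    (V_inf perc x `&` [set` l]) u -> (V_inf perc x `&` [set` l]) v ->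
    p n (x, u) = p n (x, v).
  move=> [iu lu] [iv lv]; apply/eqP/negPn/negP => neq; apply: nA.
  by exists (u, v) => //; apply/allpairsP; exists (u, v).
have [[u [Fu pu]]|nop] :=
  pselect (exists u, (V_inf perc x `&` [set` l]) u /\ p n (x, u)).
  by left=> v Fv; rewrite -(agree _ _ Fu Fv).
by right=> v Fv pv; apply: nop; exists v.
Qed.

End PropertySequence.

(** * The full group of the cluster relation *)

Local Notation Y := (X_inf rho perc).
Local Notation shift v := (act (rho * v^-1)%g).
Local Notation R_Y := (R_inf rho act perc).

Lemma measurable_X_inf : measurable Y.
Proof. exact: measurable_V_inf. Qed.

Lemma V_inf_shift x v : Y (shift v x) <-> V_inf perc x v.
Proof. by have := V_inf_act (rho * v^-1)%g x v; rewrite mulgVK. Qed.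

(** By invariance of the measure, one of the two vertices can be brought to
    the root. *)
Lemma asymptotically_constant_rooted (p : nat -> X * discr G -> bool) :
  (forall n, vertex_property act (p n)) ->
  (forall u, vanishing P
    (fun n => [set x | connected x u rho /\ p n (x, u) != p n (x, rho)])) ->
  asymptotically_constant (fun x u v => connected x u v) p.
Proof.
move=> pP rooted u v; set g := (rho * v^-1)%g.
have gv : (g * v)%g = rho by rewrite mulgVK.
have := vanishing_act g (fun n => measurable_disagree_joined pP _ _ n)
  (rooted (g * u)%g).
congr vanishing; apply/funext => n; apply/funext => x /=.
rewrite (pP n).2 -gv (pP n).2.
by rewrite (propext (connected_act g x u v)).
Qed.

(** The inverse of the correspondence taking a vertex property to the set of
    points where it holds at the root. *)
Definition shift_property (B : nat -> set X) n (q : X * discr G) : bool :=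
  `[< B n (shift q.2 q.1) >].

Lemma shift_property_root B n x : shift_property B n (x, rho) = `[< B n x >].
Proof. by rewrite /shift_property /= mulgV act1. Qed.

Lemma shift_property_vertex B n : measurable (B n) ->
  vertex_property act (shift_property B n).
Proof.
move=> mB; split.
  apply: measurable_fun_discr => v.
  apply: (@measurable_fun_bool _ _ _ _ true); rewrite setTI.
  rewrite (_ : _ @^-1` _ = shift v @^-1` B n).
    exact: measurable_act_preim.
  by apply/seteqP; split=> x /= /asboolP.
by move=> g x v; rewrite /shift_property /= -actM invgM mulgA mulgVK.
Qed.

Section Swap.
Variables (E : set X) (g : G).
Hypothesis Eg : forall x, E x -> ~ E (act g x).

(** Exchanges [E] with its translate by [g], which is disjoint from it: the
    bricks from which the full group of an orbit relation is built. *)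
Definition swap x : X :=
  if `[< E x >] then act g x
  else if `[< E (act g^-1%g x) >] then act g^-1%g x else x.

Lemma swap_in x : E x -> swap x = act g x.
Proof. by move=> /asboolT Ex; rewrite /swap Ex. Qed.

Lemma swapK : involutive swap.
Proof.
move=> x; rewrite {2}/swap; case: asboolP => Ex.
  by rewrite /swap (asboolF (Eg Ex)) actK (asboolT Ex).
case: asboolP => Egx; first by rewrite swap_in// actVK.
by rewrite /swap (asboolF Ex) (asboolF Egx).
Qed.

Lemma image_swap A : swap @` A = swap @^-1` A.
Proof.
apply/seteqP; split=> x /=; first by move=> [y Ay <-]; rewrite swapK.
by move=> Ax; exists (swap x) => //; exact: swapK.
Qed.

Lemma measurable_swap : measurable E -> measurable_fun setT swap.
Proof.
move=> mE; have masbool (A : set X) : measurable A ->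
    measurable_fun setT (fun x => `[< A x >]).
  move=> mA; apply: (@measurable_fun_bool _ _ _ _ true); rewrite setTI.
  by rewrite (_ : _ @^-1` _ = A)//; apply/seteqP; split=> x /= /asboolP.
apply: measurable_fun_ifT; [exact: masbool|exact: measurable_act|].
apply: measurable_fun_ifT; [|exact: measurable_act|exact: measurable_id].
exact/(masbool (act g^-1%g @^-1` E))/measurable_act_preim.
Qed.

End Swap.

(** On [E] the swap moves the root to [u], and on the translate of [E] it
    moves it back, inside the same infinite cluster in both cases. *)
Lemma swap_full_group (E : set X) u : measurable E ->
  E `<=` [set x | Y x /\ connected x u rho] ->
  (forall x, E x -> ~ E (shift u x)) ->
  full_group Y R_Y (swap E (rho * u^-1)%g).
Proof.
set g := (rho * u^-1)%g => mE EY Eg.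
have Yg x : E x -> Y (act g x).
  move=> /EY[Yx xu]; apply/V_inf_shift.
  exact: V_inf_connected (connected_sym xu) Yx.
have stepR x : Y x -> R_Y x (swap E g x).
  move=> Yx; rewrite /swap; case: asboolP => Ex.
    split=> //; first exact: Yg.
    exists (u * rho^-1)%g; rewrite invgF mulgVK; split=> //.
    by have [] := EY _ Ex.
  case: asboolP => Egx.
    have [Yy yu] := EY _ Egx; split=> //; exists g; split=> //.
    rewrite -{1}[x](actVK g) -{2}(mulgVK u rho); apply/connected_act.
    exact: connected_sym.
  split=> //; exists 1%g; rewrite invg1 act1 mul1g.
  by split=> //; exact: rt_refl.
split=> //; split.
- split=> [x Yx|x y _ _|x Yx].
  + by have [] := stepR x Yx.
  + exact: (can_inj (swapK Eg)).
  + by exists (swap E g x); [have [] := stepR x Yx|exact: swapK].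
- exact/measurable_funTS/measurable_swap.
- move=> A mA _; rewrite image_swap//.
  by rewrite -[_ @^-1` _]setTI; exact: measurable_swap.
Qed.

Section FullGroup.
Variable A : nat -> set X.
Hypothesis sepA : separating A.
Hypothesis Y0 : 0 < P Y.
Local Notation muY := (normalized_restriction P Y).

(** Where the property differs at [rho] and [u], the point [x] differs from its
    translate, hence some [A k] contains [x] and not the translate.  The swap
    over the set [E k] of such points is in the full group, and there its
    almost invariance is exactly the agreement of [rho] and [u]. *)
Lemma asymptotically_invariant_constant (B : nat -> set X) :
  (forall n, measurable (B n) /\ B n `<=` Y) ->
  asymptotically_invariant Y muY R_Y B ->
  asymptotically_constant (fun x u v => connected x u v) (shift_property B).
Proof.
move=> mBY Binv; have mB n : measurable (B n) by have [] := mBY n.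
have BY n : B n `<=` Y by have [] := mBY n.
have pP n := shift_property_vertex (mB n).
apply: asymptotically_constant_rooted => // u.
pose E k := [set x | (Y x /\ connected x u rho) /\ A k x /\ ~ A k (shift u x)].
have mE k : measurable (E k).
  have mAk := sepA.1 k.
  apply: measurableI.
    apply: measurableI; first exact: measurable_X_inf.
    exact: measurable_connected.
  apply: measurableI => //; apply: measurableC; exact: measurable_act_preim.
apply: (vanishing_cover (E := E)) => // [n|n x [/= ux neq]|k].
- exact: measurable_disagree_joined.
- have Yx : Y x.
    move: neq; rewrite shift_property_root; case: asboolP => [/BY//|_].
    rewrite eqbF_neg negbK => /asboolP /= /BY/V_inf_shift.
    exact: V_inf_connected.
  have [k [Ax nA]] : exists k, A k x /\ ~ A k (shift u x).
    apply: sepA.2 => xE; move: neq.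
    by rewrite shift_property_root /shift_property /= -xE eqxx.
  by exists k.
have Edisj x : E k x -> ~ E k (shift u x) by move=> [_ [_ nA]] [_ [/nA]].
have phiR : full_group Y R_Y (swap (E k) (rho * u^-1)%g).
  by apply: swap_full_group => // x [].
have mphiB n : measurable (swap (E k) (rho * u^-1)%g @` B n).
  by have [[_ _ +] _] := phiR; apply.
have mYD n : measurable ((swap (E k) (rho * u^-1)%g @` B n) `+` B n).
  by apply: measurableU; apply: measurableD.
have := Binv _ phiR; move=> /(cvg_normalized measurable_X_inf Y0 mYD).
apply: vanishing_sub => n.
- by apply: measurableI => //; exact: measurable_disagree_joined.
- by apply: measurableI => //; exact: measurable_X_inf.
rewrite image_swap// => x [Ex [_]]; have [[Yx _] _] := Ex.
rewrite shift_property_root /shift_property /= => neq; split=> //.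
rewrite /setD /= (swap_in _ Ex).
by move: neq; case: asboolP => b1; case: asboolP => b2 // _; [left|right].
Qed.

(** The cover is indexed by the vertex to which [phi] moves the root.  Its
    pieces are images under [phi], so that a point [x] of a piece comes with
    the unique preimage [y] deciding its membership in [phi @` B n], and no
    inverse of [phi] has to be formed. *)
Lemma constant_asymptotically_invariant (p : nat -> X * discr G -> bool) :
  (forall n, vertex_property act (p n)) ->
  asymptotically_constant (fun x u v => connected x u v) p ->
  asymptotically_invariant Y muY R_Y (fun n => [set x | Y x /\ p n (x, rho)]).
Proof.
move=> pP cst phi [[phiY mphi imphi] phiR].
set B := fun n => [set x | Y x /\ p n (x, rho)].
have mB n : measurable (B n).
  apply: measurableI; first exact: measurable_X_inf.
  by rewrite -[X in measurable X]setTI; exact: (measurable_prop (pP n)).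
have mphiB n : measurable (phi @` B n) by apply: imphi => // x [].
have mYD n : measurable ((phi @` B n) `+` B n).
  by apply: measurableU; apply: measurableD.
apply/(cvg_normalized measurable_X_inf Y0 mYD).
(* Equality of [phi y] with the translate is a Borel condition because the
   sequence [A] separates points. *)
pose E' v := [set y | Y y /\ (phi y = shift v y /\ connected y v rho)].
have mE' v : measurable (E' v).
  rewrite (_ : E' v = Y `&` [set y | connected y v rho] `&`
    [set y | forall k, ~ (Y y /\ A k (phi y) /\ ~ A k (shift v y))]).
    apply: measurableI.
      apply: measurableI; first exact: measurable_X_inf.
      exact: measurable_connected.
    apply: measurable_all => // k; apply: measurableC.
    rewrite [X in measurable X](_ : _ =
      (Y `&` phi @^-1` A k) `&` shift v @^-1` (~` A k)).
      apply: measurableI.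
        by apply: mphi; [exact: measurable_X_inf|exact: sepA.1].
      by apply: measurable_act_preim; apply: measurableC; exact: sepA.1.
    by apply/seteqP; split=> y /=; [move=> [? []]|move=> [[]]].
  apply/seteqP; split=> y /=.
    by move=> [Yy [phiE cy]]; split=> // k; rewrite phiE => -[_ []].
  move=> [[Yy cy] nsep]; split=> //; split=> //; apply: contrapT => neq.
  by have [k [Ak nAk]] := sepA.2 _ _ neq; apply: (nsep k).
have mE v : measurable (phi @` E' v) by apply: imphi => // y [].
have [_ phi_inj phi_surj] := phiY.
apply: (vanishing_cover (E := fun v : G => phi @` E' v)) => // [n|n x [_ Yx]|v].
- by apply: measurableI => //; exact: measurable_X_inf.
- have [y Yy yx] := phi_surj x Yx.
  have [_ _ [g [gy gc]]] := phiR _ Yy.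
  exists (g * rho)%g; exists y => //; split=> //; split=> //.
  by rewrite -gy invgM mulVKg.
have vv := vanishing_act (rho * v^-1)^-1%g
  (fun n => measurable_disagree_joined pP _ _ n) (cst v rho).
apply: vanishing_sub vv => n.
- apply: measurableI => //; apply: measurableI => //; exact: measurable_X_inf.
- by apply: measurable_act_preim; exact: measurable_disagree_joined.
move=> x [[y [Yy [phiE cy]] <-] [yD Yphi]] /=; rewrite {1 2}phiE actK.
have -> : act (rho * v^-1)^-1%g (phi y) = y by rewrite phiE actK.
split=> //; rewrite -(prop_shift (pP n)) -phiE.
case: yD => -[].
  move=> [z [Yz pz] zy] nB.
  have {}zy : z = y by apply: phi_inj; rewrite ?inE.
  move: pz; rewrite zy => ->; apply/negP => /eqP pphi; apply: nB.
  by split=> //; rewrite pphi.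
move=> [_ pphi] nB; rewrite pphi; apply/negP => /eqP py; apply: nB.
by exists y => //; split=> //; rewrite -py.
Qed.

End FullGroup.

(** * The value at the first vertex in an infinite cluster *)

Local Notation m A := (fine (P A)).

Definition first_infinite i x : Prop :=
  V_inf perc x (e i) /\ forall j, (j < i)%N -> ~ V_inf perc x (e j).

Lemma first_infinite_ex x v : V_inf perc x v -> exists i, first_infinite i x.
Proof.
have [i0 _ <-] : range e v by rewrite eT.
move=> infi0.
have exi : exists i, `[< V_inf perc x (e i) >] by exists i0; apply/asboolP.
case: (ex_minnP exi) => i /asboolP infi mini; exists i; split=> // j ji infj.
by have := mini j (asboolT infj); rewrite leqNgt ji.
Qed.

Lemma first_infinite_inj i j x :
  first_infinite i x -> first_infinite j x -> i = j.
Proof.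
move=> [infi mini] [infj minj]; have [ij|ji|//] := ltngtP i j.
  by have := minj _ ij.
by have := mini _ ji.
Qed.

Lemma measurable_first_infinite i : measurable [set x | first_infinite i x].
Proof.
apply: measurableI; first exact: measurable_V_inf.
apply: measurable_all => // j.
have [ji|nji] := pselect (j < i)%N.
  rewrite [X in measurable X](_ : _ = ~` [set x | V_inf perc x (e j)]).
    by apply: measurableC; exact: measurable_V_inf.
  by apply/seteqP; split=> x /=; auto.
rewrite [X in measurable X](_ : _ = setT)//.
by apply/seteqP; split=> x //= _ /nji.
Qed.

Section Canonical.
Variable p : nat -> X * discr G -> bool.
Hypothesis pP : forall n, vertex_property act (p n).

Definition first_value n : set X :=
  [set x | exists i, first_infinite i x /\ p n (x, e i)].

Lemma measurable_first_value n : measurable (first_value n).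
Proof.
apply: measurable_ex => // i.
apply: measurableI; first exact: measurable_first_infinite.
by rewrite -[X in measurable X]setTI; exact: (measurable_prop (pP n)).
Qed.

Lemma first_valueE n i x :
  first_infinite i x -> first_value n x <-> p n (x, e i).
Proof.
move=> fi; split=> [[j [fj pj]]|pi]; last by exists i.
by rewrite (first_infinite_inj fi fj).
Qed.

Lemma first_value_act n g j x : first_infinite j (act g^-1%g x) ->
  (act g @` first_value n) x <-> p n (x, (g * e j)%g).
Proof.
move=> fj; rewrite image_act /preimage /= (first_valueE n fj).
by rewrite -{2}[x](actVK g) (pP n).2.
Qed.

Hypothesis cst : asymptotically_constant both_infinite p.

(** Translating by [g] replaces the first vertex of [V_inf] by another vertex
    of [V_inf], and the pairs formed by these two vertices are countably many.
    Where [V_inf] is empty, neither set contains the point. *)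
Lemma first_value_invariant g :
  vanishing P (fun n => (act g @` first_value n) `+` first_value n).
Proof.
have mC := measurable_first_value.
have mgC n : measurable (act g @` first_value n).
  by rewrite image_act; exact: measurable_act_preim.
have mD n : measurable ((act g @` first_value n) `+` first_value n).
  by apply: measurableU; apply: measurableD.
pose E (ij : nat * nat) :=
  [set x | first_infinite ij.1 x /\ first_infinite ij.2 (act g^-1%g x)].
have mE ij : measurable (E ij).
  apply: measurableI; first exact: measurable_first_infinite.
  exact/(@measurable_act_preim _ [set x | first_infinite ij.2 x])
       /measurable_first_infinite.
have infg x v : V_inf perc x v <-> V_inf perc (act g^-1%g x) (g^-1 * v)%g.
  by rewrite (V_inf_act g^-1%g).
apply: (vanishing_cover (E := E)) => // [n x xD|[i j]].
  have [v infv] : exists v, V_inf perc x v.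
    case: xD => -[]; last by move=> [i [[infi _] _]] _; exists (e i).
    rewrite image_act => -[i [[infi _] _]] _; exists (g * e i)%g.
    by apply/infg; rewrite mulKg.
  have [i fi] := first_infinite_ex infv.
  have [j fj] := first_infinite_ex ((infg _ _).1 infv).
  by exists (i, j).
apply: vanishing_sub (cst (e i) (g * e j)%g) => n.
- exact: measurableI.
- exact: measurable_disagree_infinite.
move=> x [[fi fj] xD]; split.
  by split; [exact: fi.1|apply/infg; rewrite mulKg; exact: fj.1].
apply/negP => /eqP pij; case: xD => -[].
  by move=> /(first_value_act n fj); rewrite -pij => /(first_valueE n fi).
by move=> /(first_valueE n fi); rewrite pij => /(first_value_act n fj).
Qed.

Definition root_deviates n : set X :=
  [set x | Y x /\ p n (x, rho) != `[< first_value n x >]].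

Lemma measurable_root_deviates n : measurable (root_deviates n).
Proof.
apply: measurableI; first exact: measurable_X_inf.
apply: measurable_neqb; first exact: (measurable_prop (pP n)).
apply: (@measurable_fun_bool _ _ _ _ true); rewrite setTI.
rewrite (_ : _ @^-1` _ = first_value n); first exact: measurable_first_value.
by apply/seteqP; split=> x /= /asboolP.
Qed.

Lemma vanishing_root_deviates : vanishing P root_deviates.
Proof.
have mD := measurable_root_deviates.
apply: (vanishing_cover (E := fun i => [set x | first_infinite i x])) => //.
- exact: measurable_first_infinite.
- by move=> n x [Yx _]; exact: first_infinite_ex Yx.
move=> i; apply: vanishing_sub (cst rho (e i)) => n.
- by apply: measurableI => //; exact: measurable_first_infinite.
- exact: measurable_disagree_infinite.
move=> x [/= fi [Yx neq]]; split; first by split=> //; exact: fi.1.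
rewrite [X in _ != X](_ : _ = `[< first_value n x >])//.
by apply/idP/asboolP; rewrite (first_valueE n fi).
Qed.

End Canonical.

(** * Both implications *)

Section Equivalence.
Variable A : nat -> set X.
Hypothesis sepA : separating A.
Hypothesis Y0 : 0 < P Y.
Local Notation muY := (normalized_restriction P Y).

(** With [C n] the event read at the first vertex and [D n] the deviation at
    the root, [B n] is covered by [C n] and [D n], and its complement in
    [X_inf] by the complement of [C n] and [D n]; the products of
    probabilities therefore differ by a multiple of the vanishing [P (D n)]. *)
Lemma strongly_ergodic_of_indistinguishable :
  strongly_ergodic_action P act ->
  strong_indistinguishability P act perc ->
  strongly_ergodic_relation Y muY R_Y.
Proof.
move=> ergG sip B mBY Binv; have mB n : measurable (B n) by have [] := mBY n.
have pP n := shift_property_vertex (mB n).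
have /(asymptotic_cluster_propertyP pP)/sip/(indistinguishableP pP) cst :=
  asymptotically_invariant_constant sepA Y0 mBY Binv.
have mC := measurable_first_value pP.
have := ergG _ mC (first_value_invariant pP cst).
move=> /(cvg_prob_dichotomy _ mC) C0.
have mYB n : measurable (Y `\` B n).
  by apply: measurableD => //; exact: measurable_X_inf.
have mCC n : measurable (~` first_value (shift_property B) n).
  exact: measurableC.
have mD := measurable_root_deviates pP.
have /(vanishing_fine P mD) D0 := vanishing_root_deviates pP cst.
apply/(cvg_normalized_dichotomy measurable_X_inf Y0 mBY).
set C := first_value _ in mC mCC C0; set D := root_deviates _ in mD D0.
apply: (cvg0_le (b := fun n => m (C n) * m (~` C n) + 3 * m (D n))%R);
  last first.
  rewrite -(addr0 0%R); apply: cvgD => //.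
  by apply/cvg0_scale.
move=> n; rewrite mulr_ge0 ?fine_ge0//=.
have BCD : (m (B n) <= m (C n) + m (D n))%R.
  apply: le_trans (fine_probU P (mC n) (mD n)).
  apply: fine_prob_le => //; first exact: measurableU.
  move=> x Bx; have [Cx|nCx] := pselect (C n x); [by left|right].
  split; first by have [_] := mBY n; apply.
  by rewrite shift_property_root (asboolT Bx) (asboolF nCx).
have YBCD : (m (Y `\` B n) <= m (~` C n) + m (D n))%R.
  apply: le_trans (fine_probU P (mCC n) (mD n)).
  apply: fine_prob_le => //; first exact: measurableU.
  move=> x [Yx nBx]; have [Cx|nCx] := pselect (C n x); [right|by left].
  by split=> //; rewrite shift_property_root (asboolF nBx) (asboolT Cx).
have c1 := fine_prob_le1 P (mC n); have c'1 := fine_prob_le1 P (mCC n).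
have d1 := fine_prob_le1 P (mD n).
have c0 : (0 <= m (C n))%R by rewrite fine_ge0.
have c'0 : (0 <= m (~` C n))%R by rewrite fine_ge0.
have d0 : (0 <= m (D n))%R by rewrite fine_ge0.
apply: (le_trans (ler_pM _ _ BCD YBCD)); rewrite ?fine_ge0//.
nra.
Qed.

(** When [u] and [v] disagree, one of the two translates of the point lies in
    [B n] and the other in its complement in [X_inf].  The disagreement event
    is thus at most twice as likely as either of them, and its squared
    probability is bounded by four times their product. *)
Lemma indistinguishable_of_strongly_ergodic :
  strongly_ergodic_relation Y muY R_Y ->
  strong_indistinguishability P act perc.
Proof.
move=> ergR p clp; have pP := clp.1.
move/(asymptotic_cluster_propertyP pP): clp => cst.
apply/(indistinguishableP pP) => u v.
pose B n := [set x | Y x /\ p n (x, rho)].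
have mB n : measurable (B n).
  apply: measurableI; first exact: measurable_X_inf.
  by rewrite -[X in measurable X]setTI; exact: (measurable_prop (pP n)).
have mBY n : measurable (B n) /\ B n `<=` Y by split=> // x [].
have mYB n : measurable (Y `\` B n).
  by apply: measurableD => //; exact: measurable_X_inf.
have := ergR B mBY (constant_asymptotically_invariant sepA Y0 pP cst).
move=> /(cvg_normalized_dichotomy measurable_X_inf Y0 mBY) B0.
pose K n := [set x | both_infinite x u v /\ p n (x, u) != p n (x, v)].
have mK n : measurable (K n) by exact: measurable_disagree_infinite.
apply/(vanishing_fine P mK)/cvg0_sqr.
have mS w (C : set X) : measurable C -> measurable (shift w @^-1` C).
  exact: measurable_act_preim.
have twice (C : set X) n : measurable C ->
    K n `<=` shift u @^-1` C `|` shift v @^-1` C -> (m (K n) <= 2 * m C)%R.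
  move=> mC KC; have := fine_probU P (mS u _ mC) (mS v _ mC).
  have mSC := measurableU _ _ (mS u _ mC) (mS v _ mC).
  rewrite !actP//; move: (fine_prob_le P (mK n) mSC KC).
  by lra.
apply: (cvg0_le (b := fun n => 4 * (m (B n) * m (Y `\` B n)))%R); last first.
  exact/cvg0_scale.
move=> n; rewrite sqr_ge0 /=.
have leB : (m (K n) <= 2 * m (B n))%R.
  apply: twice => // x [[/V_inf_shift iu /V_inf_shift iv]].
  rewrite -(prop_shift (pP n) x u) -(prop_shift (pP n) x v) => neq.
  have [pu|npu] := boolP (p n (shift u x, rho)); first by left.
  by right; split=> //; move: neq; rewrite (negbTE npu); case: (p n _).
have leYB : (m (K n) <= 2 * m (Y `\` B n))%R.
  apply: twice => // x [[/V_inf_shift iu /V_inf_shift iv]].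
  rewrite -(prop_shift (pP n) x u) -(prop_shift (pP n) x v) => neq.
  have [pu|npu] := boolP (p n (shift u x, rho)); last first.
    by left; split=> // -[_]; exact/negP.
  by right; split=> // -[_]; move: neq; rewrite pu; case: (p n _).
rewrite expr2; apply: (le_trans (ler_pM _ _ leB leYB)); rewrite ?fine_ge0//.
by lra.
Qed.

End Equivalence.
End Percolation.

Theorem theorem3p10 (R : realType) (G : groupType) (S : set G) (rho : G)
    (d : measure_display) (X : measurableType d) (P : probability X R)
    (act : G -> X -> X) (perc : X -> config S) :
  finite_set S -> generates S ->
  generalized_percolation P act perc ->
  strongly_ergodic_action P act ->
  0 < P (X_inf rho perc) ->
  (strong_indistinguishability P act perc <->
   strongly_ergodic_relation (X_inf rho perc)
     (normalized_restriction P (X_inf rho perc)) (R_inf rho act perc)).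
Proof.
move=> finS genS [[sbX _] [act1 actM mact] actP mperc percA] ergG Y0.
have [e eT] := generates_enum finS genS.
have [A sepA] := standard_borel_separating sbX.
split.
  exact: (strongly_ergodic_of_indistinguishable act1 actM mact actP mperc
    percA eT sepA Y0 ergG).
exact: (indistinguishable_of_strongly_ergodic act1 actM mact actP mperc percA eT
  sepA Y0).
Qed.
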